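(* For all $\omega,\psi\in\mathbb{B}$: (i) $\|\omega\|\le\|\omega\|_{\mathbf{j}}\le\sqrt{2}\,\|\omega\|$; (ii) $\|\omega\psi\|_{\mathbf{j}}\le\|\omega\|_{\mathbf{j}}\|\psi\|_{\mathbf{j}}$, with equality whenever $\omega\in\mathbb{R}(\mathbf{u})$ or $\psi\in\mathbb{R}(\mathbf{u})$, for $\mathbf{u}\in\{\mathbf{i},\mathbf{k}\}$. Thus the real norm $\|\cdot\|_{\mathbf{j}}$ is submultiplicative.
   Context: $\mathbb{B}$ is the commutative real algebra of bicomplex numbers $a+b\mathbf{i}+c\mathbf{j}+d\mathbf{k}$ ($a,b,c,d\in\mathbb{R}$), with $\mathbf{i}^2=\mathbf{k}^2=-1$, $\mathbf{j}^2=1$, $\mathbf{i}\mathbf{k}=\mathbf{k}\mathbf{i}=\mathbf{j}$. For $\mathbf{u}\in\{\mathbf{i},\mathbf{k}\}$, $\mathbb{R}(\mathbf{u})=\{x+\mathbf{u}y:x,y\in\mathbb{R}\}$. $\|a+b\mathbf{i}+c\mathbf{j}+d\mathbf{k}\|=\sqrt{a^2+b^2+c^2+d^2}$ is the Euclidean norm. $\mathbb{D}=\{x+\mathbf{j}y:x,y\in\mathbb{R}\}\subset\mathbb{B}$ is the algebra of hyperbolic numbers; with $\mathbf{e}_1=\frac{1+\mathbf{j}}{2}$, $\mathbf{e}_2=\frac{1-\mathbf{j}}{2}$, each $z=x+\mathbf{j}y$ is $\pi_1(z)\mathbf{e}_1+\pi_2(z)\mathbf{e}_2$, $\pi_1(z)=x+y$,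 $\pi_2(z)=x-y$; $z\le w$ iff $\pi_k(z)\le\pi_k(w)$ for $k=1,2$; $\overline{x+\mathbf{j}y}=x-\mathbf{j}y$; $\vee$ is the supremum (componentwise maximum). Each $\omega\in\mathbb{B}$ is uniquely $\mathrm{Re}_{\mathbf{j}}(\omega)+\mathbf{i}\,\mathrm{Im}_{\mathbf{j}}(\omega)$ with $\mathrm{Re}_{\mathbf{j}}(\omega),\mathrm{Im}_{\mathbf{j}}(\omega)\in\mathbb{D}$, and $|\omega|_{\mathbf{j}}=\sqrt{\mathrm{Re}_{\mathbf{j}}(\omega)^2+\mathrm{Im}_{\mathbf{j}}(\omega)^2}\in\mathbb{D}$ (componentwise nonnegative square root). The norm $\|\cdot\|_{\mathbf{j}}$ is the Riesz subnorm of $|\cdot|_{\mathbf{j}}$: $\|\omega\|_{\mathbf{j}}=\min\{\alpha\in\mathbb{R},\alpha\ge0:\alpha\ge|\omega|_{\mathbf{j}}\}=|\omega|_{\mathbf{j}}\vee\overline{|\omega|_{\mathbf{j}}}$. *)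

(* Defs.v *)
From HB Require Import structures.
From mathcomp Require Import all_boot all_order all_algebra.
From mathcomp Require Import ring lra.
From mathcomp Require Import boolp classical_sets reals.

Set Implicit Arguments.
Unset Strict Implicit.
Unset Printing Implicit Defensive.

Import Order.TTheory GRing.Theory Num.Theory.

Local Open Scope ring_scope.
Local Open Scope classical_set_scope.

(* [Hyperbolic x y] is x + j y. *)
Record hyperbolic (R : Type) := Hyperbolic { hyp1 : R; hypj : R }.

Section HyperbolicAlgebra.
Variable R : realType.
Local Notation D := (hyperbolic R).

Definition hyp_to_pair (z : D) := (hyp1 z, hypj z).
Definition hyp_of_pair (p : R * R) : D := Hyperbolic p.1 p.2.
Lemma hyp_to_pairK : cancel hyp_to_pair hyp_of_pair. Proof. by case. Qed.

HB.instance Definition _ := Equality.copy D (can_type hyp_to_pairK).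
HB.instance Definition _ := Choice.copy D (can_type hyp_to_pairK).

Definition hyp_zero : D := Hyperbolic 0 0.
Definition hyp_opp (z : D) : D := Hyperbolic (- hyp1 z) (- hypj z).
Definition hyp_add (z w : D) : D :=
  Hyperbolic (hyp1 z + hyp1 w) (hypj z + hypj w).
Definition hyp_one : D := Hyperbolic 1 0.
Definition hyp_mul (z w : D) : D :=
  Hyperbolic (hyp1 z * hyp1 w + hypj z * hypj w)
             (hyp1 z * hypj w + hypj z * hyp1 w).
Definition hyp_scale (a : R) (z : D) : D := Hyperbolic (a * hyp1 z) (a * hypj z).

Lemma hyp_addA : associative hyp_add.
Proof. by move=> [a b] [c d] [e f]; congr Hyperbolic => /=; ring. Qed.
Lemma hyp_addC : commutative hyp_add.
Proof. by move=> [a b] [c d]; congr Hyperbolic => /=; ring. Qed.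
Lemma hyp_add0 : left_id hyp_zero hyp_add.
Proof. by move=> [a b]; congr Hyperbolic => /=; ring. Qed.
Lemma hyp_addN : left_inverse hyp_zero hyp_opp hyp_add.
Proof. by move=> [a b]; congr Hyperbolic => /=; ring. Qed.
HB.instance Definition _ :=
  GRing.isZmodule.Build D hyp_addA hyp_addC hyp_add0 hyp_addN.

Lemma hyp_mulA : associative hyp_mul.
Proof. by move=> [a b] [c d] [e f]; congr Hyperbolic => /=; ring. Qed.
Lemma hyp_mulC : commutative hyp_mul.
Proof. by move=> [a b] [c d]; congr Hyperbolic => /=; ring. Qed.
Lemma hyp_mul1 : left_id hyp_one hyp_mul.
Proof. by move=> [a b]; congr Hyperbolic => /=; ring. Qed.
Lemma hyp_mulDl : left_distributive hyp_mul hyp_add.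
Proof. by move=> [a b] [c d] [e f]; congr Hyperbolic => /=; ring. Qed.
Lemma hyp_one_neq0 : hyp_one != 0.
Proof. by apply/eqP => -[] /eqP; rewrite oner_eq0. Qed.
HB.instance Definition _ := GRing.Zmodule_isComNzRing.Build D
  hyp_mulA hyp_mulC hyp_mul1 hyp_mulDl hyp_one_neq0.

Lemma hyp_scaleA a b z : hyp_scale a (hyp_scale b z) = hyp_scale (a * b) z.
Proof. by case: z => c d; congr Hyperbolic => /=; ring. Qed.
Lemma hyp_scale1 : left_id 1 hyp_scale.
Proof. by move=> [a b]; congr Hyperbolic => /=; ring. Qed.
Lemma hyp_scaleDr : right_distributive hyp_scale +%R.
Proof. by move=> a [b c] [d e]; congr Hyperbolic => /=; ring. Qed.
Lemma hyp_scaleDl z : {morph hyp_scale^~ z : a b / a + b}.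
Proof. by case: z => c d a b; congr Hyperbolic => /=; ring. Qed.
HB.instance Definition _ := GRing.Zmodule_isLmodule.Build R D
  hyp_scaleA hyp_scale1 hyp_scaleDr hyp_scaleDl.
Lemma hyp_scaleAl (a : R) (z w : D) : a *: (z * w) = (a *: z) * w.
Proof. by case: z w => [b c] [d e]; congr Hyperbolic => /=; ring. Qed.
HB.instance Definition _ := GRing.Lmodule_isLalgebra.Build R D hyp_scaleAl.
HB.instance Definition _ := GRing.Lalgebra_isComAlgebra.Build R D.

Definition hyp_j : D := Hyperbolic 0 1.
Definition hyp_e1 : D := 2^-1 *: (1 + hyp_j).
Definition hyp_e2 : D := 2^-1 *: (1 - hyp_j).
Definition pi1 (z : D) : R := hyp1 z + hypj z.
Definition pi2 (z : D) : R := hyp1 z - hypj z.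

Lemma pi_decomp (z : D) : z = pi1 z *: hyp_e1 + pi2 z *: hyp_e2.
Proof. by case: z => a b; congr Hyperbolic; rewrite /pi1 /pi2 /=; field. Qed.
Lemma pi1_e (a b : R) : pi1 (a *: hyp_e1 + b *: hyp_e2) = a.
Proof. by rewrite /pi1 /=; field. Qed.
Lemma pi2_e (a b : R) : pi2 (a *: hyp_e1 + b *: hyp_e2) = b.
Proof. by rewrite /pi2 /=; field. Qed.
Lemma hyp_pi_inj (z w : D) : pi1 z = pi1 w -> pi2 z = pi2 w -> z = w.
Proof. by move=> h1 h2; rewrite (pi_decomp z) (pi_decomp w) h1 h2. Qed.

Definition hyp_le (z w : D) : bool := (pi1 z <= pi1 w) && (pi2 z <= pi2 w).
Lemma hyp_le_refl : reflexive hyp_le.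
Proof. by move=> z; rewrite /hyp_le !lexx. Qed.
Lemma hyp_le_anti : antisymmetric hyp_le.
Proof.
move=> z w /andP[/andP[h1 h2] /andP[h3 h4]].
by apply: hyp_pi_inj; apply/le_anti; rewrite ?h1 ?h2.
Qed.
Lemma hyp_le_trans : transitive hyp_le.
Proof.
move=> z w t /andP[h1 h2] /andP[h3 h4].
by rewrite /hyp_le (le_trans h1 h3) (le_trans h2 h4).
Qed.
(* The display [ring_display] makes [<=] in ring_scope denote this order. *)
HB.instance Definition _ := Order.Le_isPOrder.Build ring_display D
  hyp_le_refl hyp_le_anti hyp_le_trans.

Lemma hyp_leE (z w : D) : (z <= w) = (pi1 z <= pi1 w) && (pi2 z <= pi2 w).
Proof. by []. Qed.
Lemma hyp_ge0E (z : D) : (0 <= z) = (0 <= pi1 z) && (0 <= pi2 z).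
Proof.
have -> : 0 = pi1 (0 : D) by rewrite /pi1 /= addr0.
by rewrite hyp_leE; congr (_ && (_ <= _)); rewrite /pi1 /pi2 /= addr0 subr0.
Qed.

Definition hyp_meet (z w : D) : D :=
  Num.min (pi1 z) (pi1 w) *: hyp_e1 + Num.min (pi2 z) (pi2 w) *: hyp_e2.
Definition hyp_join (z w : D) : D :=
  Num.max (pi1 z) (pi1 w) *: hyp_e1 + Num.max (pi2 z) (pi2 w) *: hyp_e2.
Lemma hyp_meetP (z w t : D) : (z <= hyp_meet w t) = (z <= w) && (z <= t).
Proof. by rewrite hyp_leE pi1_e pi2_e !le_min andbACA. Qed.
Lemma hyp_joinP (z w t : D) : (hyp_join z w <= t) = (z <= t) && (w <= t).
Proof. by rewrite hyp_leE pi1_e pi2_e !ge_max andbACA. Qed.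
HB.instance Definition _ := Order.POrder_MeetJoin_isLattice.Build ring_display D
  hyp_meetP hyp_joinP.

Definition hyp_conj (z : D) : D := Hyperbolic (hyp1 z) (- hypj z).

(* [Num.sqrt] is 0 on negative reals; below it is only applied to z >= 0. *)
Definition hyp_sqrt (z : D) : D :=
  Num.sqrt (pi1 z) *: hyp_e1 + Num.sqrt (pi2 z) *: hyp_e2.

(* The minimum of the set exists: see [riesz_subnorm_min]. *)
Definition riesz_subnorm (z : D) : R :=
  inf [set alpha : R | 0 <= alpha /\ z <= alpha%:A].

Lemma hyp_le_scalar (z : D) (a : R) :
  (z <= a%:A) = (Num.max (pi1 z) (pi2 z) <= a).
Proof.
rewrite hyp_leE ge_max; congr (_ && _);
by rewrite /pi1 /pi2 /= mulr1 mulr0 ?addr0 ?subr0.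
Qed.

Lemma riesz_subnormE (z : D) : 0 <= z ->
  riesz_subnorm z = Num.max (pi1 z) (pi2 z).
Proof.
rewrite hyp_ge0E => /andP[h1 h2].
have hm : 0 <= Num.max (pi1 z) (pi2 z) by rewrite le_max h1.
rewrite /riesz_subnorm; set S := [set _ | _].
have Sm : S (Num.max (pi1 z) (pi2 z)) by split=> //; rewrite hyp_le_scalar.
have lbS : lbound S (Num.max (pi1 z) (pi2 z)).
  by move=> a [_]; rewrite hyp_le_scalar.
apply/le_anti/andP; split; last by apply: lb_le_inf => //; eexists; exact: Sm.
by apply: ge_inf => //; eexists; exact: lbS.
Qed.

Lemma riesz_subnorm_min (z : D) : 0 <= z ->
  [/\ 0 <= riesz_subnorm z, z <= (riesz_subnorm z)%:A &
      forall a : R, 0 <= a -> z <= a%:A -> riesz_subnorm z <= a].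
Proof.
move=> z0; rewrite (riesz_subnormE z0) hyp_le_scalar; split=> //.
  move: z0; rewrite hyp_ge0E => /andP[h1 _].
  by rewrite le_max h1.
by move=> a _; rewrite hyp_le_scalar.
Qed.

Lemma riesz_subnorm_join (z : D) : 0 <= z ->
  (riesz_subnorm z)%:A = Order.join z (hyp_conj z).
Proof.
move=> z0; rewrite riesz_subnormE //; apply: hyp_pi_inj.
  by rewrite [in RHS]/Order.join /= pi1_e /pi1 /pi2 /= mulr1 mulr0 addr0.
rewrite [in RHS]/Order.join /= pi2_e /pi1 /pi2 /= mulr1 mulr0 subr0 opprK.
exact: maxC.
Qed.

End HyperbolicAlgebra.

(* [Bicomplex a b c d] is a + b i + c j + d k. *)
Record bicomplex (R : Type) := Bicomplex { bc1 : R; bci : R; bcj : R; bck : R }.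

Section BicomplexAlgebra.
Variable R : realType.
Local Notation B := (bicomplex R).
Local Notation D := (hyperbolic R).

Definition bc_to_tuple (w : B) := (bc1 w, bci w, bcj w, bck w).
Definition bc_of_tuple (p : R * R * R * R) : B :=
  Bicomplex p.1.1.1 p.1.1.2 p.1.2 p.2.
Lemma bc_to_tupleK : cancel bc_to_tuple bc_of_tuple. Proof. by case. Qed.

HB.instance Definition _ := Equality.copy B (can_type bc_to_tupleK).
HB.instance Definition _ := Choice.copy B (can_type bc_to_tupleK).

Definition bc_zero : B := Bicomplex 0 0 0 0.
Definition bc_opp (w : B) : B :=
  Bicomplex (- bc1 w) (- bci w) (- bcj w) (- bck w).
Definition bc_add (w v : B) : B :=
  Bicomplex (bc1 w + bc1 v) (bci w + bci v) (bcj w + bcj v) (bck w + bck v).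
Definition bc_one : B := Bicomplex 1 0 0 0.
(* Besides i^2 = k^2 = -1, j^2 = 1 and ik = ki = j, associativity forces
   ij = ji = -k and jk = kj = -i. *)
Definition bc_mul (w v : B) : B :=
  let: Bicomplex a b c d := w in
  let: Bicomplex a' b' c' d' := v in
  Bicomplex (a * a' - b * b' + c * c' - d * d')
            (a * b' + b * a' - c * d' - d * c')
            (a * c' + c * a' + b * d' + d * b')
            (a * d' + d * a' - b * c' - c * b').
Definition bc_scale (a : R) (w : B) : B :=
  Bicomplex (a * bc1 w) (a * bci w) (a * bcj w) (a * bck w).

Lemma bc_addA : associative bc_add.
Proof. by move=> [????] [????] [????]; congr Bicomplex => /=; ring. Qed.
Lemma bc_addC : commutative bc_add.
Proof. by move=> [????] [????]; congr Bicomplex => /=; ring. Qed.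
Lemma bc_add0 : left_id bc_zero bc_add.
Proof. by move=> [????]; congr Bicomplex => /=; ring. Qed.
Lemma bc_addN : left_inverse bc_zero bc_opp bc_add.
Proof. by move=> [????]; congr Bicomplex => /=; ring. Qed.
HB.instance Definition _ :=
  GRing.isZmodule.Build B bc_addA bc_addC bc_add0 bc_addN.

Lemma bc_mulA : associative bc_mul.
Proof. by move=> [????] [????] [????]; congr Bicomplex => /=; ring. Qed.
Lemma bc_mulC : commutative bc_mul.
Proof. by move=> [????] [????]; congr Bicomplex => /=; ring. Qed.
Lemma bc_mul1 : left_id bc_one bc_mul.
Proof. by move=> [????]; congr Bicomplex => /=; ring. Qed.
Lemma bc_mulDl : left_distributive bc_mul bc_add.
Proof. by move=> [????] [????] [????]; congr Bicomplex => /=; ring. Qed.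
Lemma bc_one_neq0 : bc_one != 0.
Proof. by apply/eqP => -[] /eqP; rewrite oner_eq0. Qed.
HB.instance Definition _ := GRing.Zmodule_isComNzRing.Build B
  bc_mulA bc_mulC bc_mul1 bc_mulDl bc_one_neq0.

Lemma bc_scaleA a b w : bc_scale a (bc_scale b w) = bc_scale (a * b) w.
Proof. by case: w => ????; congr Bicomplex => /=; ring. Qed.
Lemma bc_scale1 : left_id 1 bc_scale.
Proof. by move=> [????]; congr Bicomplex => /=; ring. Qed.
Lemma bc_scaleDr : right_distributive bc_scale +%R.
Proof. by move=> a [????] [????]; congr Bicomplex => /=; ring. Qed.
Lemma bc_scaleDl w : {morph bc_scale^~ w : a b / a + b}.
Proof. by case: w => ???? a b; congr Bicomplex => /=; ring. Qed.
HB.instance Definition _ := GRing.Zmodule_isLmodule.Build R B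
  bc_scaleA bc_scale1 bc_scaleDr bc_scaleDl.
Lemma bc_scaleAl (a : R) (w v : B) : a *: (w * v) = (a *: w) * v.
Proof. by case: w v => [????] [????]; congr Bicomplex => /=; ring. Qed.
HB.instance Definition _ := GRing.Lmodule_isLalgebra.Build R B bc_scaleAl.
HB.instance Definition _ := GRing.Lalgebra_isComAlgebra.Build R B.

Definition bc_i : B := Bicomplex 0 1 0 0.
Definition bc_j : B := Bicomplex 0 0 1 0.
Definition bc_k : B := Bicomplex 0 0 0 1.

Lemma bc_table :
  [/\ bc_i ^+ 2 = -1, bc_k ^+ 2 = -1, bc_j ^+ 2 = 1,
      bc_i * bc_k = bc_j & bc_k * bc_i = bc_j].
Proof. by split; rewrite ?expr2; congr Bicomplex => /=; ring. Qed.

Lemma bc_basis (a b c d : R) :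
  Bicomplex a b c d = a%:A + b *: bc_i + c *: bc_j + d *: bc_k.
Proof. by congr Bicomplex => /=; ring. Qed.

Definition real_plane (u : B) : set B :=
  [set w | exists x y : R, w = x%:A + u * y%:A].

Definition bc_norm (w : B) : R :=
  Num.sqrt (bc1 w ^+ 2 + bci w ^+ 2 + bcj w ^+ 2 + bck w ^+ 2).

Definition bc_of_hyp (z : D) : B := (hyp1 z)%:A + bc_j * (hypj z)%:A.

Definition Re_j (w : B) : D := Hyperbolic (bc1 w) (bcj w).
(* The sign comes from i j = - k: i (b - j d) = b i + d k. *)
Definition Im_j (w : B) : D := Hyperbolic (bci w) (- bck w).

Lemma bc_of_hypM (z t : D) : bc_of_hyp (z * t) = bc_of_hyp z * bc_of_hyp t.
Proof. by case: z t => [??] [??]; congr Bicomplex => /=; ring. Qed.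

Lemma Re_Im_j (w : B) : w = bc_of_hyp (Re_j w) + bc_i * bc_of_hyp (Im_j w).
Proof. by case: w => ????; congr Bicomplex => /=; ring. Qed.

Lemma Re_Im_j_uniq (w : B) (x y : D) :
  w = bc_of_hyp x + bc_i * bc_of_hyp y -> x = Re_j w /\ y = Im_j w.
Proof.
by case: x y => [??] [??] ->; split; congr Hyperbolic => /=; ring.
Qed.

Definition mod_j (w : B) : D := hyp_sqrt (Re_j w ^+ 2 + Im_j w ^+ 2).

Definition norm_j (w : B) : R := riesz_subnorm (mod_j w).

Lemma mod_j_ge0 (w : B) : 0 <= mod_j w.
Proof. by rewrite hyp_ge0E pi1_e pi2_e !sqrtr_ge0. Qed.

Lemma sqr_mod_j (w : B) : mod_j w ^+ 2 = Re_j w ^+ 2 + Im_j w ^+ 2.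
Proof.
have pi1M (x y : D) : pi1 (x * y) = pi1 x * pi1 y by rewrite /pi1 /=; ring.
have pi2M (x y : D) : pi2 (x * y) = pi2 x * pi2 y by rewrite /pi2 /=; ring.
have pi1D (x y : D) : pi1 (x + y) = pi1 x + pi1 y by rewrite /pi1 /=; ring.
have pi2D (x y : D) : pi2 (x + y) = pi2 x + pi2 y by rewrite /pi2 /=; ring.
apply: hyp_pi_inj; rewrite expr2 ?pi1M ?pi2M ?pi1_e ?pi2_e -expr2 sqr_sqrtr //;
by rewrite ?pi1D ?pi2D !expr2 ?pi1M ?pi2M -!expr2 addr_ge0 ?sqr_ge0.
Qed.

Lemma norm_j_join (w : B) :
  (norm_j w)%:A = Order.join (mod_j w) (hyp_conj (mod_j w)).
Proof. exact/riesz_subnorm_join/mod_j_ge0. Qed.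

End BicomplexAlgebra.

Arguments bc_i {R}.
Arguments bc_j {R}.
Arguments bc_k {R}.

(* Main.v *)
(** In the idempotent coordinates [pi1], [pi2] the modulus [mod_j] is a pair of
    complex moduli, each multiplicative, and [norm_j] is the larger of the two,
    so it is submultiplicative. The mean of their squares is the squared
    Euclidean norm, which gives the comparison of the norms. On the planes R(i)
    and R(k) both moduli coincide, and then they factor out of the maximum. *)
Require Import Defs.
From HB Require Import structures.
From mathcomp Require Import all_boot all_order all_algebra.
From mathcomp Require Import ring lra.
From mathcomp Require Import boolp classical_sets reals.

Import Order.TTheory GRing.Theory Num.Theory.
Local Open Scope ring_scope.

(** Writing [w] as a + b i + c j + d k, this is the modulus of the complex number (a + c) + (b - d)
    i; the minus sign is inherited from [Im_j]. *)
Lemma pi1_mod_j (R : realType) (w : bicomplex R) :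
  pi1 (mod_j w) = Num.sqrt ((bc1 w + bcj w) ^+ 2 + (bci w - bck w) ^+ 2).
Proof.
by rewrite /mod_j /hyp_sqrt pi1_e; congr Num.sqrt; rewrite /pi1 !expr2 /=; ring.
Qed.

Lemma pi2_mod_j (R : realType) (w : bicomplex R) :
  pi2 (mod_j w) = Num.sqrt ((bc1 w - bcj w) ^+ 2 + (bci w + bck w) ^+ 2).
Proof.
by rewrite /mod_j /hyp_sqrt pi2_e; congr Num.sqrt; rewrite /pi2 !expr2 /=; ring.
Qed.

Lemma pi1_mod_j_ge0 (R : realType) (w : bicomplex R) : 0 <= pi1 (mod_j w).
Proof. by rewrite pi1_mod_j sqrtr_ge0. Qed.

Lemma pi2_mod_j_ge0 (R : realType) (w : bicomplex R) : 0 <= pi2 (mod_j w).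
Proof. by rewrite pi2_mod_j sqrtr_ge0. Qed.

(** The map sending [w] to (a + c) + (b - d) i is a ring morphism to the complex numbers. Under the
    root, [ring] checks the two-square identity. *)
Lemma pi1_mod_jM (R : realType) (w v : bicomplex R) :
  pi1 (mod_j (w * v)) = pi1 (mod_j w) * pi1 (mod_j v).
Proof.
rewrite !pi1_mod_j -sqrtrM ?addr_ge0 ?sqr_ge0 //.
by congr Num.sqrt; case: w v => [????] [????] /=; ring.
Qed.

Lemma pi2_mod_jM (R : realType) (w v : bicomplex R) :
  pi2 (mod_j (w * v)) = pi2 (mod_j w) * pi2 (mod_j v).
Proof.
rewrite !pi2_mod_j -sqrtrM ?addr_ge0 ?sqr_ge0 //.
by congr Num.sqrt; case: w v => [????] [????] /=; ring.
Qed.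

Lemma norm_jE (R : realType) (w : bicomplex R) :
  norm_j w = Num.max (pi1 (mod_j w)) (pi2 (mod_j w)).
Proof. exact/riesz_subnormE/mod_j_ge0. Qed.

Lemma norm_j_ge0 (R : realType) (w : bicomplex R) : 0 <= norm_j w.
Proof. by rewrite norm_jE le_max pi1_mod_j_ge0. Qed.

Lemma bc_norm_ge0 (R : realType) (w : bicomplex R) : 0 <= bc_norm w.
Proof. exact: sqrtr_ge0. Qed.

(** Parallelogram law, applied to the pair [bc1 w], [bcj w] and to the pair [bci w], [bck w]. *)
Lemma sqr_bc_norm (R : realType) (w : bicomplex R) :
  2 * bc_norm w ^+ 2 = pi1 (mod_j w) ^+ 2 + pi2 (mod_j w) ^+ 2.
Proof.
rewrite pi1_mod_j pi2_mod_j !sqr_sqrtr ?addr_ge0 ?sqr_ge0 //; ring.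
Qed.

Lemma bc_norm_le_norm_j (R : realType) (w : bicomplex R) :
  bc_norm w <= norm_j w.
Proof.
rewrite -ler_sqr ?nnegrE ?bc_norm_ge0 ?norm_j_ge0 //.
have le1 : pi1 (mod_j w) ^+ 2 <= norm_j w ^+ 2.
  by rewrite ler_sqr ?nnegrE ?pi1_mod_j_ge0 ?norm_j_ge0 // norm_jE le_max lexx.
have le2 : pi2 (mod_j w) ^+ 2 <= norm_j w ^+ 2.
  rewrite ler_sqr ?nnegrE ?pi2_mod_j_ge0 ?norm_j_ge0 //.
  by rewrite norm_jE le_max lexx orbT.
(* The mean of two squares, each at most [norm_j w ^+ 2], is at most [norm_j w ^+ 2]. *)
by have := sqr_bc_norm _ w; lra.
Qed.

Lemma norm_j_le_bc_norm (R : realType) (w : bicomplex R) :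
  norm_j w <= Num.sqrt 2 * bc_norm w.
Proof.
have b0 : 0 <= Num.sqrt 2 * bc_norm w.
  by rewrite mulr_ge0 ?sqrtr_ge0 ?bc_norm_ge0.
have sqb : (Num.sqrt 2 * bc_norm w) ^+ 2 = 2 * bc_norm w ^+ 2.
  by rewrite exprMn sqr_sqrtr.
rewrite norm_jE ge_max -[pi1 _ <= _]ler_sqr -1?[pi2 _ <= _]ler_sqr;
  rewrite ?nnegrE ?pi1_mod_j_ge0 ?pi2_mod_j_ge0 //.
(* The squared bound is the sum of both squared coordinates, hence dominates each of them. *)
by rewrite sqb sqr_bc_norm lerDl lerDr !sqr_ge0.
Qed.

Lemma norm_j_submul (R : realType) (w v : bicomplex R) :
  norm_j (w * v) <= norm_j w * norm_j v.
Proof.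
rewrite [norm_j (w * v)]norm_jE pi1_mod_jM pi2_mod_jM ge_max.
by rewrite !ler_pM ?pi1_mod_j_ge0 ?pi2_mod_j_ge0 // norm_jE le_max lexx ?orbT.
Qed.

Lemma norm_jM_balanced (R : realType) (w v : bicomplex R) :
  pi1 (mod_j w) = pi2 (mod_j w) -> norm_j (w * v) = norm_j w * norm_j v.
Proof.
move=> eqw; rewrite !norm_jE pi1_mod_jM pi2_mod_jM -eqw maxxx.
by rewrite maxr_pMr ?pi1_mod_j_ge0.
Qed.

(** For x + i y both radicands are x^2 + y^2; for x + k y they differ only in the sign of y before
    squaring. *)
Lemma real_plane_balanced (R : realType) (u w : bicomplex R) :
  u = bc_i \/ u = bc_k -> real_plane u w -> pi1 (mod_j w) = pi2 (mod_j w).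
Proof.
move=> u_ik [x [y ->]]; rewrite pi1_mod_j pi2_mod_j; congr Num.sqrt.
by case: u_ik => -> /=; ring.
Qed.

Theorem proposition3p10 (R : realType) (omega psi : bicomplex R) :
  (bc_norm omega <= norm_j omega /\
   norm_j omega <= Num.sqrt 2 * bc_norm omega) /\
  (norm_j (omega * psi) <= norm_j omega * norm_j psi /\
   (forall u : bicomplex R, u = bc_i \/ u = bc_k ->
      real_plane u omega \/ real_plane u psi ->
      norm_j (omega * psi) = norm_j omega * norm_j psi)).
Proof.
split; first by split; [exact: bc_norm_le_norm_j | exact: norm_j_le_bc_norm].
split=> [|u u_ik]; first exact: norm_j_submul.
case=> /(real_plane_balanced _ _ _ u_ik); first exact: norm_jM_balanced.
(* Commutativity brings the balanced factor [psi] to the left. *)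
by move=> eq_psi; rewrite [omega * psi]mulrC [RHS]mulrC norm_jM_balanced.
Qed.
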